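(* Let $\{A_t\}_{t=1}^T$ be an arbitrary sequence of matrices in $[-1,1]^{d_1\times d_2}$, let $\bar{\mathcal{L}}_t(x,y)=x^\top A_ty$, and let $G_{\bar{\mathcal{L}}}\in(0,1]$ be a constant such that every $\bar{\mathcal{L}}_t$, $t=1,\dots,T$, is $G_{\bar{\mathcal{L}}}$-Lipschitz on $\Delta_X\times\Delta_Y$ with respect to $\|\cdot\|_1$. Put $\eta=\frac{\sqrt T}{G_{\bar{\mathcal{L}}}}$ and $\theta=e^{-\eta G_{\bar{\mathcal{L}}}}$ (so that $\frac{|\ln\theta|}{\eta}=G_{\bar{\mathcal{L}}}$), and suppose $\theta\le\min\{\frac1{d_1},\frac1{d_2}\}$. Then the iterates $\{(x_t,y_t)\}_{t=1}^T$ of the algorithm OMG-RFTL with parameters $\eta,\theta$ satisfy $$\Bigl|\sum_{t=1}^Tx_t^\top A_ty_t-\min_{x\in\Delta_X}\max_{y\in\Delta_Y}\sum_{t=1}^Tx^\top A_ty\Bigr|\le 32G_{\bar{\mathcal{L}}}\sqrt T(1+\ln T)+2\sqrt T\max\{\ln d_1,\ln d_2\}+2\max\{d_1,d_2\}G_{\bar{\mathcal{L}}}Te^{-\sqrt T}.$$ In particular the right-hand side is $O\bigl(\ln(T)\sqrt T+\sqrt T\max\{\ln d_1,\ln d_2\}\bigr)+o(1)\max\{d_1,d_2\}$ as $T\to\infty$, where the constant in $O(\cdot)$ is absolute and $o(1)$ depends only on $T$.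
   Context: $\Delta_X=\{x\in\mathbb{R}^{d_1}:x\ge0,\|x\|_1=1\}$, $\Delta_Y=\{y\in\mathbb{R}^{d_2}:y\ge0,\|y\|_1=1\}$; for $\theta\ge0$, $\Delta_{X,\theta}=\{x\in\Delta_X:x_i\ge\theta\ \forall i\}$ and $\Delta_{Y,\theta}=\{y\in\Delta_Y:y_j\ge\theta\ \forall j\}$. $G$-Lipschitz w.r.t. $\|\cdot\|_1$: $|\mathcal{L}(x_1,y_1)-\mathcal{L}(x_2,y_2)|\le G(\|x_1-x_2\|_1+\|y_1-y_2\|_1)$. OMG-RFTL with parameters $\eta>0$, $\theta>0$: let $R_X(x)=\sum_{i=1}^{d_1}x_i\ln x_i+\ln d_1$ and $R_Y(y)=\sum_{j=1}^{d_2}y_j\ln y_j+\ln d_2$. Start with arbitrary $x_1\in\Delta_{X,\theta}$, $y_1\in\Delta_{Y,\theta}$. For $t\ge1$, after $A_t$ is revealed, put $\mathcal{L}_t(x,y)=x^\top A_ty+\frac1\eta R_X(x)-\frac1\eta R_Y(y)$ and set $x_{t+1}=\arg\min_{x\in\Delta_{X,\theta}}\max_{y\in\Delta_{Y,\theta}}\sum_{\tau=1}^t\mathcal{L}_\tau(x,y)$, $y_{t+1}=\arg\max_{y\in\Delta_{Y,\theta}}\min_{x\in\Delta_{X,\theta}}\sum_{\tau=1}^t\mathcal{L}_\tau(x,y)$. *)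

(* Defs.v *)
From HB Require Import structures.
From mathcomp Require Import all_boot all_order all_algebra.
From mathcomp Require Import all_classical all_reals all_analysis.

Set Implicit Arguments.
Unset Strict Implicit.
Unset Printing Implicit Defensive.

Import Order.TTheory GRing.Theory Num.Theory.
Import numFieldNormedType.Exports.

Local Open Scope classical_set_scope.
Local Open Scope ring_scope.

Definition l1norm (R : realType) (d : nat) (x : 'cV[R]_d) : R :=
  \sum_(i < d) `|x i 0|.

Definition simplex (R : realType) (d : nat) : set 'cV[R]_d :=
  [set x : 'cV[R]_d | (forall i, 0 <= x i 0) /\ l1norm x = 1].

Definition trunc_simplex (R : realType) (d : nat) (theta : R) : set 'cV[R]_d :=
  [set x : 'cV[R]_d | simplex x /\ forall i, theta <= x i 0].

Definition bilin (R : realType) (d1 d2 : nat) (A : 'M[R]_(d1, d2))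
    (x : 'cV[R]_d1) (y : 'cV[R]_d2) : R :=
  (x^T *m A *m y) 0 0.

Definition l1_lipschitz_on (R : realType) (d1 d2 : nat) (G : R)
    (D : set 'cV[R]_d1) (E : set 'cV[R]_d2)
    (L : 'cV[R]_d1 -> 'cV[R]_d2 -> R) : Prop :=
  forall x1 x2 y1 y2, D x1 -> D x2 -> E y1 -> E y2 ->
    `|L x1 y1 - L x2 y2| <= G * (l1norm (x1 - x2) + l1norm (y1 - y2)).

Section MinMax.
Context {R : realType}.

(* Attained extrema: "v = max A" and "v = min A" include existence. *)
Definition is_max (A : set R) (v : R) : Prop := A v /\ ubound A v.
Definition is_min (A : set R) (v : R) : Prop := A v /\ lbound A v.

Context {U V : Type}.
Implicit Types (D : set U) (E : set V) (F : U -> V -> R).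

(* v = min_(x in D) max_(y in E) F x y *)
Definition is_minmax D E F (v : R) : Prop :=
  is_min [set m | exists2 x, D x & is_max [set F x y | y in E] m] v.

(* v = max_(y in E) min_(x in D) F x y *)
Definition is_maxmin D E F (v : R) : Prop :=
  is_max [set m | exists2 y, E y & is_min [set F x y | x in D] m] v.

Definition argminmax D E F : set U :=
  [set x | D x /\
     exists2 v, is_max [set F x y | y in E] v & is_minmax D E F v].

Definition argmaxmin D E F : set V :=
  [set y | E y /\
     exists2 v, is_min [set F x y | x in D] v & is_maxmin D E F v].

End MinMax.

(* The library sets ln 0 = 0, so 0 * ln 0 = 0 as usual. *)
Definition entropy (R : realType) (d : nat) (x : 'cV[R]_d) : R :=
  \sum_(i < d) x i 0 * ln (x i 0) + ln d%:R.

Definition reg_payoff (R : realType) (d1 d2 : nat) (eta : R)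
    (A : 'M[R]_(d1, d2)) (x : 'cV[R]_d1) (y : 'cV[R]_d2) : R :=
  bilin A x y + eta^-1 * entropy x - eta^-1 * entropy y.

(* Rounds are numbered from 1: only A t, x t, y t with 1 <= t <= T are
   constrained, and the iterate of round t + 1 depends on A 1, ..., A t. *)
Definition omg_rftl (R : realType) (d1 d2 : nat) (eta theta : R) (T : nat)
    (A : nat -> 'M[R]_(d1, d2))
    (x : nat -> 'cV[R]_d1) (y : nat -> 'cV[R]_d2) : Prop :=
  [/\ trunc_simplex theta (x 1%N),
      trunc_simplex theta (y 1%N) &
      forall t : nat, (1 <= t < T)%N ->
        let S u v := \sum_(1 <= tau < t.+1) reg_payoff eta (A tau) u v in
        argminmax (trunc_simplex theta) (trunc_simplex theta) S (x t.+1) /\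
        argmaxmin (trunc_simplex theta) (trunc_simplex theta) S (y t.+1)].

Definition regret_bound (R : realType) (G : R) (T d1 d2 : nat) : R :=
  32%:R * G * Num.sqrt T%:R * (1 + ln T%:R)
  + 2%:R * Num.sqrt T%:R * Num.max (ln d1%:R) (ln d2%:R)
  + 2%:R * (maxn d1 d2)%:R * G * T%:R * expR (- Num.sqrt T%:R).

(* Main.v *)
(** The entropy is strongly convex for [l1norm] on the truncated simplex (with
    constant 1/4 in the place of Pinsker's 1/2, by comparison with the Hellinger
    distance) and [- ln theta]-Lipschitz, so every regularised payoff is
    2G-Lipschitz and the sum of the first n payoffs is (n / eta)-strongly
    convex-concave up to that constant.  The iterates of round n + 1 form a
    saddle point of this sum; passing from one sum to the next moves the saddle
    point by O(G eta / n), and the saddle value changes by the new payoff at the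
    old saddle point up to the Lipschitz constant times this displacement.
    Summing over n gives the harmonic sum, hence 1 + ln T.  Removing the
    regulariser costs [T / eta * max (ln d1) (ln d2)] twice, and replacing the
    truncated simplices by the full ones costs [2 d theta G T]. *)

Require Import Defs.
From HB Require Import structures.
From mathcomp Require Import all_boot all_order all_algebra.
From mathcomp Require Import all_classical all_reals all_analysis.
From mathcomp Require Import ring lra.

Set Implicit Arguments.
Unset Strict Implicit.
Unset Printing Implicit Defensive.

Import Order.TTheory GRing.Theory Num.Theory.
Import numFieldNormedType.Exports.

Local Open Scope classical_set_scope.
Local Open Scope ring_scope.

(** Stands in for letting [s] tend to 0 in optimality arguments. If [a > 0], then [s = 1/2] forces
    [b >= 2 * a], so [s = a / (2 * b)] is admissible and yields [a <= a / 2]. *)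
Lemma le0_of_small_multiples (R : realType) (a b : R) :
  (forall s, 0 < s < 1 -> a <= s * b) -> a <= 0.
Proof.
move=> h; rewrite leNgt; apply/negP => a0.
have b0 : a * 2 <= b by have := h (2^-1) ltac:(lra); lra.
have b1 : 0 < b by lra.
have s01 : 0 < a / (2 * b) < 1.
  by rewrite divr_gt0 ?mulr_gt0 // ltr_pdivrMr; lra.
have := h _ s01; have -> : a / (2 * b) * b = a / 2 by field; exact: lt0r_neq0.
by lra.
Qed.

(** * The l1 norm and truncated simplices: approximation, compactness, attained minima *)

Section L1Norm.
Context (R : realType) (d : nat).
Implicit Types (x y : 'cV[R]_d).

Lemma l1norm_ge0 x : 0 <= l1norm x.
Proof. exact: sumr_ge0. Qed.

Lemma l1normZ (a : R) x : l1norm (a *: x) = `|a| * l1norm x.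
Proof. by rewrite /l1norm mulr_sumr; apply: eq_bigr => i _; rewrite mxE normrM. Qed.

Lemma l1norm0 : l1norm (0 : 'cV[R]_d) = 0.
Proof. by rewrite /l1norm big1 // => i _; rewrite mxE normr0. Qed.

Lemma l1normN x : l1norm (- x) = l1norm x.
Proof. by rewrite -scaleN1r l1normZ normrN1 mul1r. Qed.

Lemma l1normB x y : l1norm (x - y) = l1norm (y - x).
Proof. by rewrite -l1normN opprB. Qed.

Lemma l1normD x y : l1norm (x + y) <= l1norm x + l1norm y.
Proof. by rewrite /l1norm -big_split; apply: ler_sum => i _; rewrite mxE ler_normD. Qed.

End L1Norm.

Section Simplex.
Context (R : realType) (d : nat).
Implicit Types (x y z : 'cV[R]_d).

Lemma simplex_sum x : simplex x -> \sum_i x i 0 = 1.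
Proof. by case=> x0 <-; apply: eq_bigr => i _; rewrite ger0_norm. Qed.

Lemma simplexP x : (forall i, 0 <= x i 0) -> \sum_i x i 0 = 1 -> simplex x.
Proof.
by move=> x0 x1; split=> //; rewrite -x1; apply: eq_bigr => i _; rewrite ger0_norm.
Qed.

Lemma simplex_le1 x i : simplex x -> x i 0 <= 1.
Proof.
move=> xS; rewrite -(simplex_sum xS) (bigD1 i) //= lerDl sumr_ge0 // => j _.
exact: xS.1.
Qed.

(** Lets the existence results for truncated simplices serve the full simplex as well. *)
Lemma trunc_simplex0 : @trunc_simplex R d 0 = @simplex R d.
Proof. by apply/seteqP; split=> x => [[]//|xS]; split=> //; exact: xS.1. Qed.

Lemma trunc_simplex_mix (theta s : R) x y : 0 <= s <= 1 ->
  trunc_simplex theta x -> trunc_simplex theta y ->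
  trunc_simplex theta ((1 - s) *: x + s *: y).
Proof.
move=> s01 [xS xt] [yS yt]; split; last first.
  by move=> i; rewrite !mxE; have := xt i; have := yt i; nra.
apply: simplexP => [i|].
  by rewrite !mxE; have := xS.1 i; have := yS.1 i; nra.
under eq_bigr do rewrite !mxE.
by rewrite big_split -!mulr_sumr /= !simplex_sum //; lra.
Qed.

Lemma trunc_simplex_neq0 (theta : R) : (0 < d)%N -> 0 <= theta -> theta <= d%:R^-1 ->
  @trunc_simplex R d theta !=set0.
Proof.
move=> d0 t0 td; exists (const_mx d%:R^-1); split=> [|i]; last by rewrite mxE.
apply: simplexP => [i|]; first by rewrite mxE invr_ge0.
under eq_bigr do rewrite mxE.
by rewrite sumr_const card_ord -(mulr_natr d%:R^-1) mulVf // pnatr_eq0 -lt0n.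
Qed.

(** Mixing [x] with the uniform distribution at weight [d * theta] lifts every coordinate to at
    least [theta]; the mass removed and the mass added each have norm [d * theta]. *)
Lemma trunc_simplex_approx (theta : R) x : (0 < d)%N -> 0 <= theta -> theta <= d%:R^-1 ->
  simplex x ->
  exists2 z, trunc_simplex theta z & l1norm (x - z) <= 2 * d%:R * theta.
Proof.
move=> d0 t0 td xS.
have D0 : 0 < d%:R :> R by rewrite ltr0n.
have dt : d%:R * theta <= 1 by rewrite mulrC -ler_pdivlMr // mul1r.
exists ((1 - d%:R * theta) *: x + const_mx theta).
  split=> [|i]; last by rewrite !mxE; have := xS.1 i; nra.
  apply: simplexP => [i|]; first by rewrite !mxE; have := xS.1 i; nra.
  under eq_bigr do rewrite !mxE.
  rewrite big_split /= -mulr_sumr simplex_sum // sumr_const card_ord.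
  by rewrite -(mulr_natl theta); ring.
have -> : x - ((1 - d%:R * theta) *: x + const_mx theta) =
    (d%:R * theta) *: x - const_mx theta.
  by apply/matrixP => i j; rewrite !mxE; ring.
apply: le_trans (l1normD _ _) _; rewrite l1normN l1normZ xS.2.
rewrite ger0_norm ?mulr_ge0 //.
have -> : l1norm (const_mx theta : 'cV[R]_d) = d%:R * theta.
  rewrite /l1norm (eq_bigr (fun=> theta)) => [|i _]; last by rewrite mxE ger0_norm.
  by rewrite sumr_const card_ord mulr_natl.
by lra.
Qed.

(** A closed subset of the unit cube; the transposition to row vectors is there to apply
    [rV_compact]. *)
Lemma trunc_simplex_tr_compact (theta : R) : 0 <= theta ->
  compact [set v : 'rV[R]_d | trunc_simplex theta v^T].
Proof.
move=> t0; set D := [set v | _].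
have coord i : continuous (fun v : 'rV[R]_d => v 0 i) by exact: coord_continuous.
have cube : compact [set v : 'rV[R]_d | forall i, `[0, 1]%classic (v ord0 i)].
  by apply: (@rV_compact R d (fun=> `[0, 1]%classic)) => i; exact: segment_compact.
have DE : D = (\bigcap_(i in setT) [set v : 'rV[R]_d | theta <= v 0 i]) `&`
    [set v | \sum_i v 0 i = 1].
  apply/seteqP; split => v /=.
    move=> [vS vt]; split; first by move=> i _ /=; have := vt i; rewrite mxE.
    by rewrite -(simplex_sum vS); apply: eq_bigr => i _; rewrite mxE.
  move=> [vt v1]; split=> [|i]; last by rewrite mxE; exact: vt.
  apply: simplexP => [i|]; first by rewrite mxE; apply: le_trans t0 _; exact: vt.
  by rewrite -v1; apply: eq_bigr => i _; rewrite mxE.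
have Dclosed : closed D.
  rewrite DE; apply: closedI.
    apply: closed_bigI => i _.
    by apply: (@preimage_closed _ _ _ [set r : R | theta <= r]) => //; exact: closed_ge.
  apply: (@preimage_closed _ _ (fun v : 'rV[R]_d => \sum_i v 0 i) [set r : R | r = 1]).
    move=> v _; apply: (@continuous_big _ _ +%R) => [|i _]; last exact: coord.
    exact: add_continuous.
  exact: closed_eq.
apply: (subclosed_compact Dclosed cube) => v [vS _] i /=; rewrite in_itv /=.
by have := simplex_le1 i vS; have := vS.1 i; rewrite mxE => -> ->.
Qed.

(** Source of every attained extremum below; maxima come from applying it to [- f]. As [f] is
    controlled only on the simplex, continuity is taken in the subspace topology. *)
Lemma trunc_simplex_min (theta K : R) (f : 'cV[R]_d -> R) :
  (0 < d)%N -> 0 <= theta -> theta <= d%:R^-1 ->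
  (forall x y, trunc_simplex theta x -> trunc_simplex theta y ->
    `|f x - f y| <= K * l1norm (x - y)) ->
  exists2 x, trunc_simplex theta x &
    forall y, trunc_simplex theta y -> f x <= f y.
Proof.
move=> d0 t0 td fK.
have [x0 x0D] := trunc_simplex_neq0 d0 t0 td.
pose D := [set v : 'rV[R]_d | trunc_simplex theta v^T].
have [||c cD cm] := @compact_EVT_min _ R (fun v => f v^T) D _
    (trunc_simplex_tr_compact t0).
- by exists x0^T; rewrite /D /= trmxK.
- apply/subspace_continuousP => v vD.
  apply/cvgrPdist_le => e e0.
  (* The l1 norm is at most [d] times the sup norm; the summand 1 keeps the denominator positive
     when [K = 0]. *)
  have K0 : 0 < `|K| * d%:R + 1 by apply: ltr_wpDl.
  have nb : \forall w \near v, `|v - w| <= e / (`|K| * d%:R + 1).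
    by apply: (iffLR (@cvgrPdist_le _ _ _ (nbhs v) _ id v) cvg_id); exact: divr_gt0.
  rewrite near_withinE; near=> w => wD.
  apply: le_trans (fK _ _ vD wD) _.
  have : `|v - w| <= e / (`|K| * d%:R + 1) by near: w.
  rewrite ler_pdivlMr // => vw.
  have n1 : l1norm (v^T - w^T) <= d%:R * `|v - w|.
    rewrite /l1norm; apply: le_trans (_ : \sum_(i < d) `|v - w| <= _).
      apply: ler_sum => i _; rewrite !mxE.
      have -> : v 0 i - w 0 i = (v - w) 0 i by rewrite !mxE.
      rewrite [leRHS]mx_normrE.
      exact: (le_bigmax _ (fun ij : 'I_1 * 'I_d => `|(v - w) ij.1 ij.2|) (0, i)).
    by rewrite sumr_const card_ord mulr_natl.
  have := ler_norm K; have := normr_ge0 K; have := normr_ge0 (v - w).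
  have := l1norm_ge0 (v^T - w^T).
  nra.
- exists c^T; first by move: cD; rewrite inE.
  by move=> y yD; have := cm y^T; rewrite inE /D /= trmxK; apply.
Unshelve. all: by end_near.
Qed.

End Simplex.

(** * Entropy: strong convexity, Lipschitz bound and range *)

Section Entropy.
Context (R : realType) (d : nat).
Implicit Types (x y z : 'cV[R]_d).

(* [ln u <= u - 1] at [u = sqrt (z / x)]; summed over the coordinates of two
   distributions it bounds the relative entropy by the squared Hellinger
   distance. *)
Lemma mul_ln_ratio_ge (x z : R) : 0 < x -> 0 < z ->
  (Num.sqrt x - Num.sqrt z) ^+ 2 + (x - z) <= x * (ln x - ln z).
Proof.
move=> x0 z0.
have [sx sz] : 0 < Num.sqrt x /\ 0 < Num.sqrt z by rewrite !sqrtr_gt0.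
have lnE (a : R) : 0 < a -> ln a = 2 * ln (Num.sqrt a).
  move=> a0; rewrite -{1}(sqr_sqrtr (ltW a0)) lnXn ?sqrtr_gt0 //; ring.
have q0 : 0 < Num.sqrt z / Num.sqrt x by rewrite divr_gt0.
have := @le_ln1Dx R (Num.sqrt z / Num.sqrt x - 1) ltac:(lra).
rewrite subrKC ln_div // => h.
have {}h : Num.sqrt x ^+ 2 * (ln (Num.sqrt z) - ln (Num.sqrt x)) <=
    Num.sqrt z * Num.sqrt x - Num.sqrt x ^+ 2.
  have -> : Num.sqrt z * Num.sqrt x - Num.sqrt x ^+ 2 =
     Num.sqrt x ^+ 2 * (Num.sqrt z / Num.sqrt x - 1) by field; exact: lt0r_neq0.
  by rewrite ler_wpM2l ?sqr_ge0.
have := sqr_sqrtr (ltW x0); have := sqr_sqrtr (ltW z0).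
rewrite (lnE x) // (lnE z) // => hz hx; move: h; rewrite hx; nra.
Qed.

(** A Pinsker-type inequality: the first-order remainder of the entropy at [z] is the relative
    entropy of [x] to [z]. The constant 1 in the gradient [1 + ln (z i 0)] drops out because the
    coordinates of [x - z] sum to 0. *)
Lemma entropy_gap (theta : R) x z : 0 < theta ->
  trunc_simplex theta x -> trunc_simplex theta z ->
  entropy z + \sum_i ln (z i 0) * (x i 0 - z i 0) + 4^-1 * l1norm (x - z) ^+ 2
    <= entropy x.
Proof.
move=> t0 [xS xt] [zS zt].
have x0 i : 0 < x i 0 by exact: lt_le_trans (xt i).
have z0 i : 0 < z i 0 by exact: lt_le_trans (zt i).
pose a i := Num.sqrt (x i 0) - Num.sqrt (z i 0).
pose b i := Num.sqrt (x i 0) + Num.sqrt (z i 0).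
have hellinger : \sum_i a i ^+ 2 <= \sum_i x i 0 * (ln (x i 0) - ln (z i 0)).
  have -> : \sum_i a i ^+ 2 = \sum_i (a i ^+ 2 + (x i 0 - z i 0)).
    by rewrite big_split /= sumrB !simplex_sum // subrr addr0.
  by apply: ler_sum => i _; exact: mul_ln_ratio_ge.
have dE : \sum_i x i 0 * (ln (x i 0) - ln (z i 0)) =
    entropy x - entropy z - \sum_i ln (z i 0) * (x i 0 - z i 0).
  rewrite /entropy opprD addrACA subrr addr0 -!sumrB.
  by apply: eq_bigr => i _; ring.
set N := l1norm _.
have N0 : 0 <= N by exact: l1norm_ge0.
(* AM-GM in [|x_i - z_i| = |a_i| b_i], with [\sum_i b_i^2 <= 4] *)
have NN : N ^+ 2 <= \sum_i (2 * a i ^+ 2 + N ^+ 2 / 4 * (x i 0 + z i 0)).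
  rewrite [leLHS]expr2 [leLHS]mulr_sumr; apply: ler_sum => i _; rewrite !mxE.
  have -> : x i 0 - z i 0 = a i * b i.
    by rewrite /a /b -subr_sqr !sqr_sqrtr ?ltW.
  have b0 : 0 <= b i by rewrite addr_ge0 ?sqrtr_ge0.
  have bE : x i 0 + z i 0 = (a i ^+ 2 + b i ^+ 2) / 2.
    by rewrite -(sqr_sqrtr (ltW (x0 i))) -(sqr_sqrtr (ltW (z0 i))) /a /b; field.
  rewrite bE normrM (ger0_norm b0) -[a i ^+ 2]real_normK ?num_real //.
  have := sqr_ge0 (`|a i| - N * b i / 4); have := sqr_ge0 (N * `|a i|).
  by nra.
(* Both distributions have mass 1, so half of [N ^+ 2] is absorbed and [N ^+ 2 / 4] is at most the
   Hellinger sum. *)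
have : \sum_i (2 * a i ^+ 2 + N ^+ 2 / 4 * (x i 0 + z i 0)) =
    2 * (\sum_i a i ^+ 2) + N ^+ 2 / 4 * 2.
  by rewrite big_split /= -!mulr_sumr big_split /= !simplex_sum.
by lra.
Qed.

(** Apply [entropy_gap] at the mixture towards [x] and [y] and average with weights [1 - s] and [s]:
    the linear terms cancel, and the squares combine by [(1 - s) * s^2 + s * (1 - s)^2 = s * (1 -
    s)]. *)
Lemma entropy_strongly_convex (theta s : R) x y : 0 < theta -> 0 <= s <= 1 ->
  trunc_simplex theta x -> trunc_simplex theta y ->
  entropy ((1 - s) *: x + s *: y) + 4^-1 * (s * (1 - s)) * l1norm (x - y) ^+ 2
    <= (1 - s) * entropy x + s * entropy y.
Proof.
move=> t0 s01 xD yD; set z := _ *: _ + _ *: _.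
have zD : trunc_simplex theta z by exact: trunc_simplex_mix.
have xz : x - z = s *: (x - y) by apply/matrixP => i j; rewrite !mxE; ring.
have yz : y - z = (1 - s) *: (y - x) by apply/matrixP => i j; rewrite !mxE; ring.
have := entropy_gap t0 yD zD; have := entropy_gap t0 xD zD.
rewrite xz yz !l1normZ (l1normB y x) !ger0_norm; try lra.
set N := l1norm _; set X := \sum_i _; set Y := \sum_i _.
have XY : (1 - s) * X + s * Y = 0.
  rewrite !mulr_sumr -big_split big1 // => i _; rewrite !mxE /=; ring.
rewrite !exprMn; nra.
Qed.

(** The tangent inequality at the first point has slopes [ln (x i 0)], which lie between [ln theta]
    and 0. *)
Lemma entropy_lipschitz (theta : R) x y : 0 < theta ->
  trunc_simplex theta x -> trunc_simplex theta y ->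
  `|entropy x - entropy y| <= - ln theta * l1norm (x - y).
Proof.
move=> t0.
suff H x' y' : trunc_simplex theta x' -> trunc_simplex theta y' ->
    entropy x' - entropy y' <= - ln theta * l1norm (x' - y').
  move=> xD yD; rewrite ler_norml lerNl opprB (H x) // andbT l1normB.
  exact: H.
move=> [xS xt] [yS yt].
have := @entropy_gap theta y' x' t0 (conj yS yt) (conj xS xt).
have : - (\sum_i ln (x' i 0) * (y' i 0 - x' i 0)) <= - ln theta * l1norm (x' - y').
  rewrite -sumrN /l1norm mulr_sumr; apply: ler_sum => i _; rewrite !mxE.
  have lnx : ln theta <= ln (x' i 0) <= 0.
    rewrite ln_le0 ?simplex_le1 // andbT ler_ln ?posrE //.
    exact: lt_le_trans (xt i).
  have := ler_norm (y' i 0 - x' i 0); have := normr_ge0 (y' i 0 - x' i 0).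
  by rewrite distrC; nra.
have := sqr_ge0 (l1norm (y' - x')).
by lra.
Qed.

(** The entropy is the relative entropy to the uniform distribution. Coordinates may vanish here, so
    [mul_ln_ratio_ge] is used coordinatewise and zero coordinates are treated apart. *)
Lemma entropy_ge0 x : simplex x -> 0 <= entropy x.
Proof.
move=> xS; have d0 : 0 < d%:R :> R.
  rewrite ltr0n lt0n; apply/eqP => d0.
  have /eqP := simplex_sum xS; rewrite big1 => [|i]; first by rewrite eq_sym oner_eq0.
  by have := ltn_ord i; rewrite {2}d0.
have -> : entropy x = \sum_i x i 0 * (ln (x i 0) - ln d%:R^-1).
  under eq_bigr do rewrite mulrBr.
  by rewrite sumrB -mulr_suml simplex_sum // mul1r lnV // opprK.
have S0 : \sum_i (x i 0 - d%:R^-1) = 0.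
  rewrite sumrB simplex_sum // sumr_const card_ord -(mulr_natr d%:R^-1).
  by rewrite mulVf ?subrr // lt0r_neq0.
rewrite -[leLHS]S0; apply: ler_sum => i _; have [x0|x0] := ltP 0 (x i 0).
  have := mul_ln_ratio_ge x0 (z := d%:R^-1); rewrite invr_gt0 => /(_ d0).
  by have := sqr_ge0 (Num.sqrt (x i 0) - Num.sqrt d%:R^-1); lra.
have -> : x i 0 = 0 by apply/eqP; rewrite eq_le x0 xS.1.
by rewrite mul0r sub0r oppr_le0 invr_ge0 ltW.
Qed.

Lemma entropy_le_ln x : simplex x -> entropy x <= ln d%:R.
Proof.
move=> xS; rewrite /entropy gerDr sumr_le0 // => i _.
by rewrite mulr_ge0_le0 ?xS.1 // ln_le0 // simplex_le1.
Qed.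

End Entropy.

(** * Saddle points and independently chosen optimal strategies *)

Section Saddle.
Context {R : realType} {U V : Type}.
Implicit Types (D : set U) (E : set V) (F : U -> V -> R).

Definition saddle D E F (x : U) (y : V) : Prop :=
  [/\ D x, E y, forall u, D u -> F x y <= F u y & forall w, E w -> F x w <= F x y].

Lemma saddle_eq D E F F' x y : (forall u w, F u w = F' u w) ->
  saddle D E F x y -> saddle D E F' x y.
Proof.
by move=> FF' [Dx Ey xm ym]; split=> // [u|w]; rewrite -!FF'; [apply: xm|apply: ym].
Qed.

(** If [v'] is the max-min value, then [F x w <= F x y' <= v' <= F u y] for all [u] and [w]: [y']
    competes in the max-min, and [y] attains it. *)
Lemma argminmax_argmaxmin_saddle D E F x y :
  argminmax D E F x -> argmaxmin D E F y ->
  (exists y', saddle D E F x y') -> saddle D E F x y.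
Proof.
move=> [Dx _] [Ey [v' [_ v'l] [_ v'm]]] [y' [_ Ey' xm ym]].
have le1 : F x y' <= v'.
  by apply: v'm; exists y' => //; split=> [|_ [u Du <-]]; [exists x|exact: xm].
split=> // [u Du|w Ew].
  by apply: le_trans (ym _ Ey) _; apply: le_trans le1 _; apply: v'l; exists u.
by apply: le_trans (ym _ Ew) _; apply: le_trans le1 _; apply: v'l; exists x.
Qed.

End Saddle.

(** * Regularised payoffs: growth at optima and existence of saddle points *)

Section Payoff.
Context (R : realType).

Lemma bilin_mixl (d1 d2 : nat) (A : 'M[R]_(d1, d2)) (s : R) x x' y :
  bilin A ((1 - s) *: x + s *: x') y = (1 - s) * bilin A x y + s * bilin A x' y.
Proof. by rewrite /bilin linearD !linearZ /= !mulmxDl -!scalemxAl !mxE. Qed.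

Lemma bilin_trN (d1 d2 : nat) (A : 'M[R]_(d1, d2)) x y :
  bilin (- A^T) y x = - bilin A x y.
Proof.
rewrite /bilin mulmxN mulNmx mxE; congr (- _).
by rewrite -[in RHS](trmxK (x^T *m _ *m _)) [in RHS]mxE !trmx_mul trmxK mulmxA.
Qed.

Lemma bilin_sum (d1 d2 : nat) (A : nat -> 'M[R]_(d1, d2)) m n x y :
  bilin (\sum_(m <= t < n) A t) x y = \sum_(m <= t < n) bilin (A t) x y.
Proof. by rewrite /bilin mulmx_sumr mulmx_suml summxE. Qed.

(** Exchanging the players turns results for the minimising player into results for the maximising
    one. *)
Lemma reg_payoff_trN (d1 d2 : nat) (eta : R) (A : 'M[R]_(d1, d2)) x y :
  reg_payoff eta (- A^T) y x = - reg_payoff eta A x y.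
Proof. rewrite /reg_payoff bilin_trN; ring. Qed.

(** A cumulative game is again a single regularised game, so the one-game lemmas apply to it with
    [eta / n] for [eta]. *)
Lemma reg_payoff_sum (d1 d2 : nat) (eta : R) (A : nat -> 'M[R]_(d1, d2)) n x y :
  \sum_(1 <= t < n.+1) reg_payoff eta (A t) x y =
  reg_payoff (eta / n%:R) (\sum_(1 <= t < n.+1) A t) x y.
Proof.
rewrite /reg_payoff sumrB big_split /= bilin_sum !sumr_const_nat subn1 /=.
by rewrite invf_div -[_ *+ n]mulr_natl -[X in _ - X]mulr_natl !mulrA.
Qed.

Section Truncated.
Context (d1 d2 : nat) (theta eta : R) (A : 'M[R]_(d1, d2)).
Hypotheses (theta0 : 0 < theta) (eta0 : 0 < eta).
Local Notation D := (@trunc_simplex R d1 theta).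
Local Notation E := (@trunc_simplex R d2 theta).
Local Notation F := (reg_payoff eta A).

Lemma reg_payoff_mixl s x x' y : 0 <= s <= 1 -> D x -> D x' ->
  F ((1 - s) *: x + s *: x') y
    + (4 * eta)^-1 * (s * (1 - s)) * l1norm (x - x') ^+ 2
  <= (1 - s) * F x y + s * F x' y.
Proof.
move=> s01 Dx Dx'; have := entropy_strongly_convex theta0 s01 Dx Dx'.
have e0 : 0 <= eta^-1 by rewrite invr_ge0 ltW.
move=> /(ler_wpM2l e0); rewrite /reg_payoff bilin_mixl invfM.
set N := l1norm _ ^+ 2; set e := entropy (_ + _); lra.
Qed.

(** Compare [x] with the point a fraction [s] of the way to [x'], use strong convexity, divide by
    [s] and let [s] tend to 0. *)
Lemma reg_payoff_min_growth x x' y : D x -> D x' ->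
  (forall u, D u -> F x y <= F u y) ->
  F x y + (4 * eta)^-1 * l1norm (x' - x) ^+ 2 <= F x' y.
Proof.
move=> Dx Dx' xm; rewrite -subr_le0.
apply: (@le0_of_small_multiples _ _ ((4 * eta)^-1 * l1norm (x' - x) ^+ 2)).
move=> s /andP[s0 s1]; have s01 : 0 <= s <= 1 by rewrite !ltW.
rewrite -(ler_pM2l s0); have := reg_payoff_mixl y s01 Dx Dx'.
have := xm _ (trunc_simplex_mix s01 Dx Dx'); rewrite (l1normB x).
set N := l1norm _ ^+ 2; set c := (4 * eta)^-1; lra.
Qed.

Lemma reg_payoff_lipschitz G :
  l1_lipschitz_on G (@simplex R d1) (@simplex R d2) (bilin A) ->
  l1_lipschitz_on (G - ln theta / eta) D E F.
Proof.
move=> L x1 x2 y1 y2 Dx1 Dx2 Ey1 Ey2.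
have e0 : 0 <= eta^-1 by rewrite invr_ge0 ltW.
have := L _ _ _ _ Dx1.1 Dx2.1 Ey1.1 Ey2.1.
have := entropy_lipschitz theta0 Dx1 Dx2 => /(ler_wpM2l e0).
have := entropy_lipschitz theta0 Ey1 Ey2 => /(ler_wpM2l e0).
set Nx := l1norm _; set Ny := l1norm _ => hy hx hb.
rewrite (_ : _ - _ = (bilin A x1 y1 - bilin A x2 y2) +
   (eta^-1 * (entropy x1 - entropy x2) - eta^-1 * (entropy y1 - entropy y2))).
  apply: le_trans (ler_normD _ _) _.
  apply: le_trans (lerD hb (ler_normB _ _)) _.
  by rewrite !normrM (ger0_norm e0); lra.
by rewrite /reg_payoff; ring.
Qed.

End Truncated.

(** A maximum of [K]-Lipschitz functions is [K]-Lipschitz, so after the inner maximum the outer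
    minimum is attained too. *)
Lemma l1_lipschitz_minmax (d1 d2 : nat) (theta K : R) F :
  (0 < d1)%N -> (0 < d2)%N -> 0 <= theta ->
  theta <= d1%:R^-1 -> theta <= d2%:R^-1 ->
  l1_lipschitz_on K (@trunc_simplex R d1 theta) (@trunc_simplex R d2 theta) F ->
  exists v, is_minmax (@trunc_simplex R d1 theta) (@trunc_simplex R d2 theta) F v.
Proof.
move=> d10 d20 t0 t1 t2 L.
have /choice[Y ymax] x : exists y, trunc_simplex theta x ->
    is_max [set F x w | w in trunc_simplex theta] (F x y).
  have [Dx|nDx] := pselect (trunc_simplex theta x); last by exists 0.
  have [w w' Ew Ew'|y Ey ym] :=
    @trunc_simplex_min _ _ theta K (fun w => - F x w) d20 t0 t2.
    rewrite -opprD normrN; apply: le_trans (L _ _ _ _ Dx Dx Ew Ew') _.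
    by rewrite subrr l1norm0 add0r.
  exists y => _; split=> [|_ [w Ew <-]]; first by exists y.
  by rewrite -lerN2 ym.
pose m x := F x (Y x).
have [x x' Dx Dx'|x Dx xm] := @trunc_simplex_min _ _ _ K m d10 t0 t1.
  suff H a b : trunc_simplex theta a -> trunc_simplex theta b ->
      m a - m b <= K * l1norm (a - b).
    by rewrite ler_norml lerNl opprB (H x) // andbT l1normB; exact: H.
  move=> Da Db; have [[y Ey ya] _] := ymax a Da; have [_ ub] := ymax b Db.
  have := ub _ (ex_intro2 _ _ y Ey erefl).
  have := L _ _ _ _ Da Db Ey Ey; rewrite ler_norml subrr l1norm0 addr0 ya /m.
  by lra.
exists (m x); split; first by exists x => //; exact: ymax.
move=> _ [u Du [[w Ew <-] uw]]; apply: le_trans (xm _ Du) _.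
by apply: uw; have [] := ymax u Du.
Qed.

(* Let [y] maximise [F x], and for [s > 0] let [ys] maximise [F xs] where
   [xs = (1 - s) x + s u].  Optimality of [x] and convexity give
   [F x y <= F u ys], while the strong concavity of [F x] forces
   [ys --> y] as [s --> 0]; hence [F x y <= F u y]. *)
Lemma argminmax_saddle (d1 d2 : nat) (theta eta K : R) (A : 'M[R]_(d1, d2)) x :
  (0 < d2)%N -> 0 < theta -> theta <= d2%:R^-1 -> 0 < eta -> 0 <= K ->
  l1_lipschitz_on K (@trunc_simplex R d1 theta) (@trunc_simplex R d2 theta)
    (reg_payoff eta A) ->
  argminmax (@trunc_simplex R d1 theta) (@trunc_simplex R d2 theta)
    (reg_payoff eta A) x ->
  exists y, saddle (@trunc_simplex R d1 theta) (@trunc_simplex R d2 theta)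
    (reg_payoff eta A) x y.
Proof.
move=> d20 t0 t2 eta0 K0 L [Dx [v [[y Ey yv] vub] [_ vmin]]].
set F := reg_payoff eta A in L yv vub vmin *.
have ym w : trunc_simplex theta w -> F x w <= F x y.
  by move=> Ew; rewrite yv; apply: vub; exists w.
exists y; split=> // u Du; rewrite leNgt; apply/negP; rewrite -subr_gt0.
set delta := F x y - F u y => delta0.
suff : delta ^+ 2 <= 0 by apply/negP; rewrite -ltNge exprn_gt0.
pose M := l1norm (x - u).
(* With [N] the distance from [ys] to [y], the factor combines [delta <= K * N] with
   [N ^+ 2 <= 4 * eta * (s * (K * M))]. *)
apply: (@le0_of_small_multiples _ _ (K ^+ 2 * (4 * eta * (K * M)))).
move=> s /andP[s0 s1]; have s01 : 0 <= s <= 1 by rewrite !ltW.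
pose xs := (1 - s) *: x + s *: u.
have Dxs : trunc_simplex theta xs by exact: trunc_simplex_mix.
have [w w' Ew Ew'|ys Es ysm] :=
  @trunc_simplex_min _ _ theta K (fun w => - F xs w) d20 (ltW t0) t2.
  rewrite -opprD normrN; apply: le_trans (L _ _ _ _ Dxs Dxs Ew Ew') _.
  by rewrite subrr l1norm0 add0r.
have h1 : F x y <= F xs ys.
  rewrite yv; apply: vmin; exists xs => //; split=> [|_ [w Ew <-]]; first by exists ys.
  by rewrite -lerN2 ysm.
have h2 := reg_payoff_mixl A t0 eta0 ys s01 Dx Du; rewrite -/F -/xs in h2.
have h3 := ym _ Es.
have c0 : 0 < (4 * eta)^-1 by rewrite invr_gt0 mulr_gt0.
have s1' : 0 <= 1 - s by lra.
have h4 : F x y <= F u ys.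
  have {}h2 : F xs ys <= (1 - s) * F x ys + s * F u ys.
    apply: le_trans h2; rewrite lerDl mulr_ge0 ?sqr_ge0 //.
    by rewrite (mulr_ge0 (ltW c0)) ?(mulr_ge0 (ltW s0)).
  by rewrite -(ler_pM2l s0); have := ler_wpM2l s1' h3; lra.
pose N := l1norm (ys - y).
have N0 : 0 <= N := l1norm_ge0 _.
(* Growth at the maximiser [y] bounds the left side by [F x y - F x ys], hence by [F xs ys - F x ys]
   through [h1]; [xs] is at distance [s * M] from [x]. *)
have h5 : (4 * eta)^-1 * N ^+ 2 <= s * (K * M).
  have := @reg_payoff_min_growth _ _ theta eta (- A^T) t0 eta0 y ys x Ey Es.
  rewrite !reg_payoff_trN -/F => /(_ _)/wrap[].
    by move=> w Ew; rewrite reg_payoff_trN lerN2; exact: ym.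
  have := L _ _ _ _ Dxs Dx Es Es.
  have -> : xs - x = s *: (u - x) by apply/matrixP => i j; rewrite !mxE; ring.
  rewrite subrr l1norm0 addr0 l1normZ (l1normB u) -/M (ger0_norm (ltW s0)).
  by rewrite ler_norml -/N; lra.
have h6 : delta <= K * N.
  have := L _ _ _ _ Du Du Es Ey; rewrite subrr l1norm0 add0r ler_norml -/N /delta.
  by lra.
have h7 : N ^+ 2 <= 4 * eta * (s * (K * M)).
  by rewrite -ler_pdivrMl ?mulr_gt0.
apply: le_trans (_ : (K * N) ^+ 2 <= _).
  by rewrite ler_sqr ?nnegrE ?(ltW delta0) ?mulr_ge0.
rewrite exprMn; have := ler_wpM2l (sqr_ge0 K) h7; lra.
Qed.

End Payoff.

(** Each new term [1/m] is at most [ln m - ln (m - 1)], by [ln (1 + u) <= u] at [u = - 1/m]. *)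
Lemma harmonic_sum_le (R : realType) (n : nat) : (0 < n)%N ->
  \sum_(1 <= t < n.+1) (t%:R : R)^-1 <= 1 + ln n%:R.
Proof.
case: n => // n _; elim: n => [|n IH].
  by rewrite big_nat1 invr1 ln1 addr0.
rewrite big_nat_recr //=; apply: le_trans (lerD IH (lexx _)) _.
rewrite -addrA lerD2l -lerBrDl.
have n0 : 0 < n.+1%:R :> R by rewrite ltr0n.
have m0 : 0 < n.+2%:R :> R by rewrite ltr0n.
have i1 : n.+2%:R^-1 < 1 :> R by rewrite invf_lt1 // ltr1n.
have i0 : 0 < n.+2%:R^-1 :> R by rewrite invr_gt0.
have := @le_ln1Dx R (- n.+2%:R^-1); rewrite ltrN2 => /(_ i1).
have mE : n.+2%:R - 1 = n.+1%:R :> R by rewrite -natr1 addrK.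
have -> : 1 - n.+2%:R^-1 = n.+1%:R / n.+2%:R :> R.
  by rewrite -[X in X - _](divff (lt0r_neq0 m0)) -[X in _ - X]mul1r -mulrBl mE.
by rewrite ln_div // -[leLHS]opprB lerN2.
Qed.

(** * Stability of saddle points and comparison with the minimax value *)

Section Regret.
Context (R : realType) (d1 d2 : nat).
Implicit Types (x : 'cV[R]_d1) (y : 'cV[R]_d2) (F L : 'cV[R]_d1 -> 'cV[R]_d2 -> R).

(* Follow the leader: adding [L] moves the saddle point by at most [2 K / c]. *)
Lemma saddle_value_step D E F F' L (K c : R) x y x' y' : 0 <= K -> 0 < c ->
  (forall u w, F' u w = F u w + L u w) -> l1_lipschitz_on K D E L ->
  saddle D E F x y -> saddle D E F' x' y' ->
  F' x' y' + c * l1norm (x - x') ^+ 2 <= F' x y' ->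
  F' x' y + c * l1norm (y - y') ^+ 2 <= F' x' y' ->
  `|L x y - (F' x' y' - F x y)| <= 2 * K ^+ 2 / c.
Proof.
move=> K0 c0 FE LK [Dx Ey xm ym] [Dx' Ey' xm' ym'].
set a := l1norm (x - x'); set b := l1norm (y - y') => ga gb.
have a0 : 0 <= a := l1norm_ge0 _; have b0 : 0 <= b := l1norm_ge0 _.
have ab : c * (a + b) <= 2 * K.
  (* Add the two growth inequalities: the [F] part [F x y' - F x' y] is nonpositive by the old
     saddle point, leaving [L x y' - L x' y]. *)
  have : c * (a ^+ 2 + b ^+ 2) <= K * (a + b).
    have := LK _ _ _ _ Dx Dx' Ey' Ey; rewrite (l1normB y') -/a -/b ler_norml.
    have := ym _ Ey'; have := xm _ Dx'; move: ga gb; rewrite !FE; lra.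
  have [ab0|ab0] := leP (a + b) 0; first by nra.
  (* Uses [(a + b)^2 <= 2 * (a^2 + b^2)]. *)
  move=> h; rewrite -(ler_pM2r ab0).
  by have := mulr_ge0 (ltW c0) (sqr_ge0 (a - b)); lra.
have Kab : K * (a + b) <= 2 * K ^+ 2 / c.
  by rewrite ler_pdivlMr //; have := ler_wpM2l K0 ab; lra.
(* The two saddle properties place [F' x' y' - F x y] between [L x' y] and [L x y'], which differ
   from [L x y] by at most [K * a] and [K * b]. *)
have := LK _ _ _ _ Dx Dx Ey' Ey; rewrite subrr l1norm0 add0r (l1normB y') -/b ler_norml.
have := LK _ _ _ _ Dx' Dx Ey Ey; rewrite subrr l1norm0 addr0 (l1normB x') -/a ler_norml.
have := xm' _ Dx; have := ym' _ Ey; have := ym _ Ey'; have := xm _ Dx'.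
have := mulr_ge0 K0 a0; have := mulr_ge0 K0 b0.
rewrite (FE x y') (FE x' y) ler_norml; move: Kab; rewrite mulrDr; lra.
Qed.

Context (theta : R) (theta0 : 0 < theta).
Local Notation D := (@trunc_simplex R d1 theta).
Local Notation E := (@trunc_simplex R d2 theta).

Lemma saddle_growth (eta : R) (A : 'M[R]_(d1, d2)) x y u w : 0 < eta -> D u -> E w ->
  saddle D E (reg_payoff eta A) x y ->
  reg_payoff eta A x y + (4 * eta)^-1 * l1norm (u - x) ^+ 2 <= reg_payoff eta A u y /\
  reg_payoff eta A x w + (4 * eta)^-1 * l1norm (w - y) ^+ 2 <= reg_payoff eta A x y.
Proof.
move=> eta0 Du Ew [Dx Ey xm ym]; split.
  exact: (reg_payoff_min_growth theta0).
have := @reg_payoff_min_growth _ _ _ _ _ (- A^T) theta0 eta0 y w x Ey Ew.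
rewrite !reg_payoff_trN => /(_ _)/wrap[].
  by move=> v Ev; rewrite reg_payoff_trN lerN2; exact: ym.
by lra.
Qed.

(** Induction on [n] over all saddle points of [S n]: the iterates provide one for [n < T] only,
    while the conclusion is needed at [n = T]. *)
Lemma saddle_regret (eta : R) (A : nat -> 'M[R]_(d1, d2)) (K : R) (T : nat)
    (x : nat -> 'cV[R]_d1) (y : nat -> 'cV[R]_d2) : 0 < eta -> 0 <= K ->
  let S n u w := \sum_(1 <= t < n.+1) reg_payoff eta (A t) u w in
  (forall t, (1 <= t <= T)%N -> l1_lipschitz_on K D E (reg_payoff eta (A t))) ->
  (forall n, (n < T)%N -> saddle D E (S n) (x n.+1) (y n.+1)) ->
  forall n x' y', (n <= T)%N -> saddle D E (S n) x' y' ->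
  `|\sum_(1 <= t < n.+1) reg_payoff eta (A t) (x t) (y t) - S n x' y'|
    <= 8 * eta * K ^+ 2 * \sum_(1 <= t < n.+1) t%:R^-1.
Proof.
move=> eta0 K0 S LK sad; elim=> [|n IH] x' y' nT sad'.
  by rewrite /S !big_geq // subrr normr0 mulr0.
have SE u w : S n.+1 u w = S n u w + reg_payoff eta (A n.+1) u w.
  by rewrite /S big_nat_recr.
have Sn := sad n nT; have {IH} := IH _ _ (ltnW nT) Sn.
have [Dx Ey _ _] := Sn.
have n0 : 0 < n.+1%:R :> R by rewrite ltr0n.
have e0 : 0 < eta / n.+1%:R by rewrite divr_gt0.
have c0 : 0 < (4 * (eta / n.+1%:R))^-1 by rewrite invr_gt0 mulr_gt0.
have sadB : saddle D E (reg_payoff (eta / n.+1%:R) (\sum_(1 <= t < n.+2) A t)) x' y'.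
  by apply: saddle_eq sad' => u w; rewrite /S reg_payoff_sum.
have [] := saddle_growth e0 Dx Ey sadB; rewrite -!reg_payoff_sum -/(S n.+1 _ _) => gx gy.
(* Here [c = (n + 1) / (4 * eta)], so the step costs [8 * eta * K^2 / (n + 1)]. *)
have := saddle_value_step K0 c0 SE (LK n.+1 nT) Sn sad' gx gy.
rewrite ![\sum_(1 <= t < n.+2) _]big_nat_recr //= => h1 h2.
rewrite mulrDr (_ : _ - _ = (\sum_(1 <= t < n.+1) reg_payoff eta (A t) (x t) (y t)
    - S n (x n.+1) (y n.+1)) + (reg_payoff eta (A n.+1) (x n.+1) (y n.+1)
    - (S n.+1 x' y' - S n (x n.+1) (y n.+1)))); last by ring.
apply: le_trans (ler_normD _ _) _; apply: lerD => //; apply: le_trans h1 _.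
by rewrite le_eqVlt; apply/orP; left; apply/eqP; field; rewrite !lt0r_neq0.

Qed.

Lemma saddle_value_approx (B : 'M[R]_(d1, d2)) (eta M v : R) x y : 0 < eta ->
  (0 < d1)%N -> (0 < d2)%N -> theta <= d1%:R^-1 -> theta <= d2%:R^-1 -> 0 <= M ->
  l1_lipschitz_on M (@simplex R d1) (@simplex R d2) (bilin B) ->
  is_minmax (@simplex R d1) (@simplex R d2) (bilin B) v ->
  saddle D E (reg_payoff eta B) x y ->
  `|reg_payoff eta B x y - v|
    <= eta^-1 * Num.max (ln d1%:R) (ln d2%:R) + 2 * (maxn d1 d2)%:R * M * theta.
Proof.
move=> eta0 d10 d20 t1 t2 M0 L [[xh xhS [[yh yhS yhE] vub]] vmin] [Dx Ey xm ym].
have ei0 : 0 <= eta^-1 by rewrite invr_ge0 ltW.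
have ent_le d (z : 'cV[R]_d) : simplex z -> (d == d1) || (d == d2) -> 
    eta^-1 * entropy z <= eta^-1 * Num.max (ln d1%:R) (ln d2%:R).
  move=> zS dd; rewrite ler_wpM2l // le_max.
  by have := entropy_le_ln zS; case/orP: dd => /eqP <- ->; rewrite ?orbT.
have approx d : (0 < d)%N -> theta <= d%:R^-1 -> (d <= maxn d1 d2)%N ->
    forall z : 'cV[R]_d, simplex z -> exists2 z', trunc_simplex theta z' &
    M * l1norm (z - z') <= 2 * (maxn d1 d2)%:R * M * theta.
  move=> d0 td dm z zS; have [z' z'D zz'] := trunc_simplex_approx d0 (ltW theta0) td zS.
  exists z' => //; apply: le_trans (ler_wpM2l M0 zz') _.
  have dm' : d%:R <= (maxn d1 d2)%:R :> R by rewrite ler_nat.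
  by have := mulr_ge0 M0 (ltW theta0); nra.
rewrite ler_norml; apply/andP; split.
  (* Lower bound: [v] is at most the payoff of a best reply [yb] to [x] in the full simplex, and the
     saddle point is tested against a truncation of [yb]. *)
  have d2i : 0 <= d2%:R^-1 :> R by rewrite invr_ge0.
  have [w w' Ew Ew'|yb yb0 ybm] :=
    @trunc_simplex_min _ d2 0 M (fun w => - bilin B x w) d20 (lexx 0) d2i.
    rewrite trunc_simplex0 in Ew Ew'; rewrite -opprD normrN.
    apply: le_trans (L _ _ _ _ Dx.1 Dx.1 Ew Ew') _.
    by rewrite subrr l1norm0 add0r.
  rewrite trunc_simplex0 in yb0 ybm.
  have vle : v <= bilin B x yb.
    apply: vmin; exists x; first exact: Dx.1.
    split=> [|_ [w Ew <-]]; first by exists yb.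
    by rewrite -lerN2 ybm.
  have [yt ytE yyt] := approx _ d20 t2 (leq_maxr _ _) _ yb0.
  have := L _ _ _ _ Dx.1 Dx.1 yb0 ytE.1; rewrite subrr l1norm0 add0r ler_norml.
  have := ent_le _ _ ytE.1; rewrite eqxx orbT => /(_ erefl).
  have := mulr_ge0 ei0 (entropy_ge0 Dx.1).
  have := ym _ ytE; rewrite {1}/reg_payoff; lra.
(* Upper bound: the saddle point is tested against a truncation of the minimax strategy [xh]. *)
have [xt xtD xxt] := approx _ d10 t1 (leq_maxl _ _) _ xhS.
have := L _ _ _ _ xhS xtD.1 Ey.1 Ey.1; rewrite subrr l1norm0 addr0 ler_norml.
have := ent_le _ _ xtD.1; rewrite eqxx => /(_ erefl).
have := mulr_ge0 ei0 (entropy_ge0 Ey.1).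
have : bilin B xh y <= v by apply: vub; exists y => //; exact: Ey.1.
have := xm _ xtD; rewrite {2}/reg_payoff; lra.
Qed.

End Regret.

(** * Asymptotics of the bound *)

Lemma expR_sqrt_decay (R : realType) (n : nat) :
  n%:R * expR (- Num.sqrt n%:R) <= 48 * harmonic n :> R.
Proof.
have s0 : 0 <= Num.sqrt n%:R :> R by exact: sqrtr_ge0.
(* The fourth-order term gives [1 + n^2 / 24 <= expR (sqrt n)], and
   [n * (n + 1) <= 48 + 2 * n^2]. *)
have := expR_ge1Dxn 3 s0.
have -> : Num.sqrt n%:R ^+ 4 = (n%:R ^+ 2 : R) by rewrite (exprM _ 2 2) sqr_sqrtr.
rewrite (_ : 4`!%:R = 24 :> R) // => h.
rewrite expRN ler_pdivrMr ?expR_gt0 // /harmonic mulrAC ler_pdivlMr ?ltr0n // -natr1.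
have : 0 <= n%:R :> R by [].
by move: h; nra.
Qed.

(** From [n >= e] on, [1 + ln n <= 2 * ln n], whence 64 from 32; 96 is twice the 48 of
    [expR_sqrt_decay]. *)
Lemma regret_bound_asymptotic (R : realType) (n d1 d2 : nat) (G : R) :
  expR 1 <= n%:R :> R -> (0 < d1)%N -> (0 < d2)%N -> 0 < G <= 1 ->
  `|regret_bound G n d1 d2|
    <= 64 * (ln n%:R * Num.sqrt n%:R
              + Num.sqrt n%:R * Num.max (ln d1%:R) (ln d2%:R))
       + (96 * harmonic n) * (maxn d1 d2)%:R.
Proof.
move=> ne d10 d20 /andP[G0 G1].
have l1 : 1 <= ln n%:R :> R.
  rewrite -[leLHS]expRK ler_ln ?posrE ?expR_gt0 //.
  by apply: lt_le_trans ne; exact: expR_gt0.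
have s0 : 0 <= Num.sqrt n%:R :> R by exact: sqrtr_ge0.
have m0 : 0 <= Num.max (ln d1%:R) (ln d2%:R) :> R.
  by rewrite le_max ln_ge0 // ler1n.
have D0 : 0 <= (maxn d1 d2)%:R :> R by [].
have E0 : 0 <= n%:R * expR (- Num.sqrt n%:R) :> R by rewrite mulr_ge0 ?expR_ge0.
rewrite /regret_bound.
have h1 : 0 <= 32 * G * Num.sqrt n%:R * (1 + ln n%:R) <= 64 * (ln n%:R * Num.sqrt n%:R).
  apply/andP; split; first by rewrite !mulr_ge0 ?(ltW G0) //; lra.
  have : Num.sqrt n%:R * (1 + ln n%:R) <= 2 * (ln n%:R * Num.sqrt n%:R) :> R.
    by have := ler_wpM2l s0 l1; lra.
  have := mulr_ge0 s0 (le_trans ler01 l1).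
  have : 0 <= Num.sqrt n%:R * (1 + ln n%:R) :> R by rewrite mulr_ge0 //; lra.
  by nra.
have h2 : 0 <= Num.sqrt n%:R * Num.max (ln d1%:R) (ln d2%:R) :> R by rewrite mulr_ge0.
have h3 : 0 <= 2 * (maxn d1 d2)%:R * G * n%:R * expR (- Num.sqrt n%:R)
    <= 96 * harmonic n * (maxn d1 d2)%:R.
  have -> : 2 * (maxn d1 d2)%:R * G * n%:R * expR (- Num.sqrt n%:R) =
    2 * (maxn d1 d2)%:R * (G * (n%:R * expR (- Num.sqrt n%:R))) by ring.
  rewrite !mulr_ge0 ?(ltW G0) ?expR_ge0 // andTb.
  have GE : G * (n%:R * expR (- Num.sqrt n%:R)) <= 48 * harmonic n.
    by apply: le_trans (expR_sqrt_decay R n); rewrite ler_piMl.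
  by have := ler_wpM2l D0 GE; lra.
by rewrite ger0_norm; lra.
Qed.

(** * Assembly of the regret bound *)

Theorem theorem3 (R : realType) :
  (forall (d1 d2 T : nat) (A : nat -> 'M[R]_(d1, d2)) (G eta theta : R)
      (x : nat -> 'cV[R]_d1) (y : nat -> 'cV[R]_d2),
    (0 < d1)%N -> (0 < d2)%N -> (0 < T)%N ->
    (forall t, (1 <= t <= T)%N -> forall i j, -1 <= A t i j <= 1) ->
    0 < G <= 1 ->
    (forall t, (1 <= t <= T)%N ->
       l1_lipschitz_on G (@simplex R d1) (@simplex R d2) (bilin (A t))) ->
    eta = Num.sqrt T%:R / G ->
    theta = expR (- (eta * G)) ->
    theta <= Num.min (d1%:R^-1) (d2%:R^-1) ->
    omg_rftl eta theta T A x y ->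
    exists2 v : R,
      is_minmax (@simplex R d1) (@simplex R d2)
        (fun u w => \sum_(1 <= t < T.+1) bilin (A t) u w) v &
      `|\sum_(1 <= t < T.+1) bilin (A t) (x t) (y t) - v|
        <= regret_bound G T d1 d2)
  /\
  (exists (C : R) (eps : nat -> R),
    eps @ \oo --> (0 : R) /\
    \forall T \near \oo, forall (d1 d2 : nat) (G : R),
      (0 < d1)%N -> (0 < d2)%N -> 0 < G <= 1 ->
      `|regret_bound G T d1 d2|
        <= C * (ln T%:R * Num.sqrt T%:R
                + Num.sqrt T%:R * Num.max (ln d1%:R) (ln d2%:R))
           + eps T * (maxn d1 d2)%:R).
Proof.
split; last first.
  exists 64, (fun n => 96 * harmonic n); split.
    by rewrite -[X in _ --> X](mulr0 (96 : R)); apply: cvgMr; exact: cvg_harmonic.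
  near=> T => d1 d2 G; apply: regret_bound_asymptotic.
  near: T; exact: nbhs_infty_ger.
move=> d1 d2 T A G eta theta x y d10 d20 T0 _ /andP[G0 G1] AL etaE thetaE.
rewrite le_min => /andP[t1 t2] [x1 y1 step].
have s0 : 0 < Num.sqrt T%:R :> R by rewrite sqrtr_gt0 ltr0n.
have eta0 : 0 < eta by rewrite etaE divr_gt0.
have etaG : eta * G = Num.sqrt T%:R by rewrite etaE divfK // lt0r_neq0.
have theta0 : 0 < theta by rewrite thetaE expR_gt0.
have lntheta : ln theta = - (eta * G) by rewrite thetaE expRK.
have BL n : (n <= T)%N -> l1_lipschitz_on (n%:R * G) (@simplex R d1) (@simplex R d2)
    (bilin (\sum_(1 <= t < n.+1) A t)).
  move=> nT u1 u2 w1 w2 Du1 Du2 Ew1 Ew2; rewrite !bilin_sum -sumrB.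
  apply: le_trans (ler_norm_sum _ _ _) _; rewrite -mulrA.
  apply: le_trans (_ : \sum_(1 <= t < n.+1) (G * (l1norm (u1 - u2) + l1norm (w1 - w2))) <= _).
    rewrite !big_nat; apply: ler_sum => t /andP[t0 tn]; apply: AL => //.
    by rewrite t0 (leq_trans _ nT).
  by rewrite sumr_const_nat subn1 mulr_natl.
(* The choice of [theta] makes [- ln theta / eta = G], so the regularisers cost another [G]. *)
have LK t : (1 <= t <= T)%N -> l1_lipschitz_on (2 * G) (@trunc_simplex R d1 theta)
    (@trunc_simplex R d2 theta) (reg_payoff eta (A t)).
  move=> tT; have := reg_payoff_lipschitz theta0 eta0 (AL t tT).
  by rewrite lntheta (_ : G - _ = 2 * G) //; field; rewrite lt0r_neq0.
pose S n u w := \sum_(1 <= t < n.+1) reg_payoff eta (A t) u w.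
have SE n : S n = reg_payoff (eta / n%:R) (\sum_(1 <= t < n.+1) A t).
  by apply/funext => u; apply/funext => w; rewrite /S reg_payoff_sum.
have SL n : (0 < n <= T)%N -> exists2 K, 0 <= K &
    l1_lipschitz_on K (@trunc_simplex R d1 theta) (@trunc_simplex R d2 theta) (S n).
  move=> /andP[n0 nT]; have en0 : 0 < eta / n%:R by rewrite divr_gt0 ?ltr0n.
  have L := reg_payoff_lipschitz theta0 en0 (BL n nT); rewrite -SE in L.
  exists (n%:R * G - ln theta / (eta / n%:R)) => //.
  rewrite lntheta mulNr opprK addr_ge0 ?mulr_ge0 ?(ltW G0) //.
    exact: ltW.
  by rewrite invr_ge0 ltW.
have argS n u : (0 < n <= T)%N ->
    argminmax (@trunc_simplex R d1 theta) (@trunc_simplex R d2 theta) (S n) u ->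
    exists w, saddle (@trunc_simplex R d1 theta) (@trunc_simplex R d2 theta) (S n) u w.
  move=> nT; have [K K0] := SL n nT; rewrite SE; apply: argminmax_saddle => //.
  by rewrite divr_gt0 // ltr0n; case/andP: nT.
have sad n : (n < T)%N -> saddle (@trunc_simplex R d1 theta) (@trunc_simplex R d2 theta)
    (S n) (x n.+1) (y n.+1).
  case: n => [_|n nT].
    (* [S 0] is an empty sum, so the arbitrary starting pair is a saddle point of it. *)
    by split=> // [u|w] _; rewrite /S !big_geq.
  have [xa ya] := step n.+1 nT.
  by apply: argminmax_argmaxmin_saddle => //; apply: argS xa; rewrite /= ltnW.
(* The game of all [T] rounds has no iterate attached, so its saddle point is obtained from an
   existence argument. *)
have [u [w uw]] : exists u w,
    saddle (@trunc_simplex R d1 theta) (@trunc_simplex R d2 theta) (S T) u w.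
  have TT : (0 < T <= T)%N by rewrite T0 leqnn.
  have [K K0 KL] := SL T TT.
  have [v vS] := l1_lipschitz_minmax d10 d20 (ltW theta0) t1 t2 KL.
  have [[u Du uv] _] := vS.
  by have [|w uw] := @argS T u TT; [split=> //; exists v | exists u, w].
have [v vS] : exists v, is_minmax (@simplex R d1) (@simplex R d2)
    (bilin (\sum_(1 <= t < T.+1) A t)) v.
  have := @l1_lipschitz_minmax R d1 d2 0 (T%:R * G)
    (bilin (\sum_(1 <= t < T.+1) A t)) d10 d20.
  by rewrite !trunc_simplex0; apply; rewrite ?invr_ge0 //; exact: BL.
exists v.
  have -> : (fun u w => \sum_(1 <= t < T.+1) bilin (A t) u w) =
    bilin (\sum_(1 <= t < T.+1) A t).
    by apply/funext => ?; apply/funext => ?; rewrite bilin_sum.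
  exact: vS.
have eT0 : 0 < eta / T%:R by rewrite divr_gt0 ?ltr0n.
have TG0 : 0 <= T%:R * G by rewrite mulr_ge0 // ltW.
have G20 : 0 <= 2 * G by lra.
set m := Num.max (ln d1%:R) (ln d2%:R : R).
have regret := saddle_regret theta0 eta0 G20 LK sad (leqnn T) uw.
have uw' := uw; rewrite SE in uw'.
have value :=
  saddle_value_approx theta0 eT0 d10 d20 t1 t2 TG0 (BL T (leqnn T)) vS uw'.
rewrite -SE in value.
(* Each round contributes a difference of two entropies lying in the interval from 0 to [m], so only
   one [m] is paid per round. *)
have entropies : `|\sum_(1 <= t < T.+1) bilin (A t) (x t) (y t) -
    \sum_(1 <= t < T.+1) reg_payoff eta (A t) (x t) (y t)| <= T%:R * (eta^-1 * m).
  rewrite -sumrB; apply: le_trans (ler_norm_sum _ _ _) _.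
  apply: le_trans (_ : \sum_(1 <= t < T.+1) (eta^-1 * m) <= _); last first.
    by rewrite sumr_const_nat subn1 mulr_natl.
  rewrite !big_nat; apply: ler_sum => -[//|t] /andP[_ tT].
  have [[xS _] [yS _] _ _] := sad t tT.
  rewrite (_ : _ - _ = eta^-1 * (entropy (y t.+1) - entropy (x t.+1))); last first.
    by rewrite /reg_payoff; ring.
  have ei0 : 0 <= eta^-1 by rewrite invr_ge0 ltW.
  rewrite normrM (ger0_norm ei0) ler_wpM2l // ler_norml.
  have := entropy_ge0 xS; have := entropy_ge0 yS.
  have := entropy_le_ln xS; have := entropy_le_ln yS.
  have : ln d1%:R <= m by rewrite le_max lexx.
  have : ln d2%:R <= m by rewrite le_max lexx orbT.
  by lra.
have H1 := harmonic_sum_le R T0.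
have m0 : 0 <= m by rewrite le_max ln_ge0 // ler1n.
have TE : T%:R = Num.sqrt T%:R * (eta * G) by rewrite etaG -expr2 sqr_sqrtr.
(* [T / eta = G * sqrt T] and [G <= 1]; this cost occurs in both [entropies] and [value], whence the
   factor 2 in the bound. *)
have Tm : T%:R * (eta^-1 * m) <= Num.sqrt T%:R * m.
  have -> : T%:R * (eta^-1 * m) = G * (Num.sqrt T%:R * m).
    by rewrite [in LHS]TE; field; rewrite lt0r_neq0.
  by rewrite ler_piMl // mulr_ge0 // ltW.
have HG : 8 * eta * (2 * G) ^+ 2 * \sum_(1 <= t < T.+1) (t%:R)^-1 <=
    32 * G * Num.sqrt T%:R * (1 + ln T%:R).
  have -> : 8 * eta * (2 * G) ^+ 2 = 32 * G * Num.sqrt T%:R by rewrite -etaG; ring.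
  by rewrite ler_wpM2l // !mulr_ge0 // ltW.
move: value; rewrite invf_div thetaE etaG => value.
rewrite /regret_bound.
rewrite (_ : _ - v = (\sum_(1 <= t < T.+1) bilin (A t) (x t) (y t) -
    \sum_(1 <= t < T.+1) reg_payoff eta (A t) (x t) (y t)) +
    (\sum_(1 <= t < T.+1) reg_payoff eta (A t) (x t) (y t) - S T u w) +
    (S T u w - v)); last by ring.
apply: le_trans (ler_normD _ _) _; apply: le_trans (lerD (ler_normD _ _) (lexx _)) _.
have := lerD (lerD entropies regret) value; rewrite -/m -mulrA.
by move: Tm HG; lra.
Unshelve. all: by end_near.
Qed.
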